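(* Let $\mathbb{A}$ be a nonnegative tensor of order $m\ge 2$ and dimension $n=2$. Then $\mathbb{A}$ is primitive if and only if its majorization matrix $M(\mathbb{A})$ is a primitive matrix.
   Context: For a tensor $\mathbb{A}=(a_{i_1\ldots i_m})$ of order $m$ and dimension $n$ and $x\in\mathbb{R}^n$, $\mathbb{A}x\in\mathbb{R}^n$ is defined by $(\mathbb{A}x)_i=\sum_{i_2,\ldots,i_m=1}^n a_{ii_2\ldots i_m}x_{i_2}\cdots x_{i_m}$. For $x\ge0$ let $T_{\mathbb{A}}(x)=(\mathbb{A}x)^{[1/(m-1)]}$, where $y^{[r]}=(y_1^r,\ldots,y_n^r)^T$. A nonnegative tensor $\mathbb{A}$ is primitive if there is a positive integer $r$ with $T_{\mathbb{A}}^r(x)>0$ (entrywise) for all nonnegative nonzero $x\in\mathbb{R}^n$. The majorization matrix $M(\mathbb{A})$ is the $n\times n$ matrix with $(M(\mathbb{A}))_{ij}=a_{ij\ldots j}$. A nonnegative square matrix $A$ is primitive if $A^k$ is entrywise positive for some positive integer $k$. *)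

(* Defs.v *)
From HB Require Import structures.
From mathcomp Require Import all_boot all_order all_algebra.
From mathcomp Require Import reals exp.

Set Implicit Arguments.
Unset Strict Implicit.
Unset Printing Implicit Defensive.

Import Order.TTheory GRing.Theory Num.Theory.
Local Open Scope ring_scope.

Section Tensors.
Variables (R : realType) (m n : nat).

(* The entry a_{i_1 ... i_m} is [A [tuple i_1; ...; i_m]]. *)
Definition tensor := m.-tuple 'I_n -> R.

Implicit Types (A : tensor) (x : 'cV[R]_n) (M : 'M[R]_n).

Definition nonneg_tensor A := forall t, 0 <= A t.

Definition nonneg_vec x := forall i, 0 <= x i 0.

Definition pos_vec x := forall i, 0 < x i 0.

(* The sum over i_2, ..., i_m is a sum over the multi-indices
   t = (i_1, ..., i_m) with i_1 = i. *)
Definition tensor_app A x : 'cV[R]_n :=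
  \col_i \sum_(t : m.-tuple 'I_n | ohead t == Some i)
           A t * \prod_(j <- behead t) x j 0.

Definition tensor_map A x : 'cV[R]_n :=
  \col_i (tensor_app A x i 0) `^ (m.-1)%:R^-1.

Definition primitive_tensor A :=
  nonneg_tensor A /\
  exists r : nat, (0 < r)%N /\
    forall x, nonneg_vec x -> x != 0 -> pos_vec (iter r (tensor_map A) x).

Definition majorization_matrix A : 'M[R]_n :=
  \matrix_(i, j) A [tuple (if val k == 0%N then i else j) | k < m].

Definition primitive_matrix M :=
  (forall i j, 0 <= M i j) /\
  exists k : nat, (0 < k)%N /\ forall i j, 0 < (M ^+ k) i j.

End Tensors.

(* Main.v *)
Require Import Defs.
From HB Require Import structures.
From mathcomp Require Import all_boot all_order all_algebra.
From mathcomp Require Import reals exp.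

Set Implicit Arguments.
Unset Strict Implicit.
Unset Printing Implicit Defensive.

(** Write T for [tensor_map A] and M for the majorization matrix.  In every
    dimension the support of T x contains that of M x, with equality when x is
    supported on a single index.  The inclusion makes A primitive as soon as M
    is.  Conversely, primitivity of A forbids a family of indices such that
    vectors supported on one of them are mapped to vectors supported on one of
    them.  In dimension 2 this rules out a zero off-diagonal entry of M and a
    zero diagonal, and what remains is exactly M ^+ 2 > 0. *)

Import Order.TTheory GRing.Theory Num.Theory.
Local Open Scope ring_scope.

Section Supports.
Variables (R : realType) (m n : nat).
Implicit Types (A : tensor R m n) (x : 'cV[R]_n) (M N : 'M[R]_n).

Local Notation maj_tuple i j :=
  [tuple (if val k == 0%N then i else j) | k < m].

Definition supported_at (j : 'I_n) x := forall k, k != j -> x k 0 = 0.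

Lemma nonneg_tensor_map A x : nonneg_vec (tensor_map A x).
Proof. by move=> i; rewrite mxE powR_ge0. Qed.

Lemma nonneg_iter_tensor_map A x r :
  nonneg_vec x -> nonneg_vec (iter r (tensor_map A) x).
Proof. by case: r => // r _; exact: nonneg_tensor_map. Qed.

Lemma maj_tuple_head (i j : 'I_n) : (0 < m)%N -> ohead (maj_tuple i j) = Some i.
Proof.
move=> m0; have := tnth_mktuple (fun k => if val k == 0%N then i else j)
  (Ordinal m0).
move: (maj_tuple i j) => t /= <-; rewrite (tnth_nth i) /=.
by case: (tval t) (size_tuple t) => //= m00; rewrite -m00 in m0.
Qed.

Lemma maj_tuple_behead (i j : 'I_n) k : k \in behead (maj_tuple i j) -> k = j.
Proof.
case/(nthP j) => l; rewrite size_behead size_tuple nth_behead => lm <-.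
have lm' : (l.+1 < m)%N by rewrite -ltn_predRL.
by rewrite (nth_map (Ordinal lm')) ?size_enum_ord //= nth_enum_ord.
Qed.

Lemma eq_maj_tuple (t : m.-tuple 'I_n) (i j : 'I_n) :
  ohead t = Some i -> (forall k, k \in behead t -> k = j) -> t = maj_tuple i j.
Proof.
move=> ti tj; apply: eq_from_tnth => k; rewrite tnth_mktuple (tnth_nth j).
case: k => -[|k] km /=; first by move: ti; case: (tval t) => //= ? ? [].
rewrite -nth_behead; apply: tj; apply: mem_nth.
by rewrite size_behead size_tuple ltn_predRL.
Qed.

(** The summand at [maj_tuple i j] is a positive coefficient times a power of [x j 0]; all other
    summands are nonnegative. *)
Lemma tensor_map_gt0 A x (i j : 'I_n) : (0 < m)%N ->
    nonneg_tensor A -> nonneg_vec x ->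
  0 < majorization_matrix A i j -> 0 < x j 0 -> 0 < tensor_map A x i 0.
Proof.
move=> m0 A0 x0; rewrite !mxE => Aij xj; apply: powR_gt0.
rewrite (bigD1 (maj_tuple i j)) ?maj_tuple_head //=.
apply: ltr_pwDl; last first.
  by apply: sumr_ge0 => t _; apply: mulr_ge0 => //; apply: prodr_ge0 => k _.
apply: mulr_gt0 => //; rewrite big_seq; apply: prodr_gt0 => k.
by move/maj_tuple_behead->.
Qed.

(** Every multi-index starting with [i], other than [maj_tuple i j], contributes a factor
    [x k 0 = 0] with [k != j]. *)
Lemma tensor_map_eq0 A x (i j : 'I_n) : (1 < m)%N ->
  supported_at j x -> majorization_matrix A i j = 0 -> tensor_map A x i 0 = 0.
Proof.
move=> m1 xj; rewrite !mxE => Aij; rewrite big1 ?powR0 //.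
  (* The exponent must be nonzero, since a zero exponent would give 1 at base 0; this is where
     [1 < m] enters. *)
  by rewrite invr_eq0 pnatr_eq0 -lt0n ltn_predRL.
move=> t /eqP ti; have [/allP tj|] := boolP (all (pred1 j) (behead t)).
  by rewrite (eq_maj_tuple (j := j) ti) ?Aij ?mul0r // => k /tj/eqP.
case/allPn => k kt kj.
by rewrite (big_rem k) //= xj // mul0r mulr0.
Qed.

Lemma mulmx_gt0_ex M N (i j : 'I_n) :
    (forall k l, 0 <= M k l) -> 0 < (M *m N) i j ->
  exists k, 0 < M i k /\ 0 < N k j.
Proof.
move=> M0 MN; case: (pickP (fun k => (0 < M i k) && (0 < N k j))).
  by move=> k /andP[? ?]; exists k.
move=> none; move: MN; rewrite mxE ltNge sumr_le0 // => k _.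
move: (none k); rewrite lt_neqAle M0 andbT eq_sym.
have [->|_ /=] := eqVneq (M i k) 0; first by rewrite mul0r.
by move=> /negbT; rewrite -leNgt; exact: mulr_ge0_le0.
Qed.

(** A positive entry of the [r]-th power yields a walk of length [r] through positive entries of the
    matrix, and positivity of a coordinate spreads along it. *)
Lemma iter_tensor_map_gt0 A x r (i j : 'I_n) : (0 < m)%N ->
    nonneg_tensor A -> nonneg_vec x ->
    0 < (majorization_matrix A ^+ r) i j -> 0 < x j 0 ->
  0 < iter r (tensor_map A) x i 0.
Proof.
move=> m0 A0 x0 + xj; elim: r i => [|r IHr] i.
  rewrite expr0 -idmxE mxE; by case: eqP => [->//|]; rewrite ltxx.
rewrite exprS -mulmxE => /mulmx_gt0_ex[k l|k [ik kj]]; first by rewrite mxE.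
apply: (tensor_map_gt0 (j := k)) => //; first exact: nonneg_iter_tensor_map.
exact: IHr.
Qed.

Lemma primitive_majorization_tensor A : (0 < m)%N -> nonneg_tensor A ->
  primitive_matrix (majorization_matrix A) -> primitive_tensor A.
Proof.
move=> m0 A0 [_ [k [k0 Mk]]]; split => //; exists k; split => // x x0 xn0 i.
have [j xj] : exists j, x j 0 != 0.
  have [j xj|z] := pickP (fun j => x j 0 != 0); first by exists j.
  case/eqP: xn0; apply/matrixP => j l; rewrite ord1 mxE.
  exact/eqP/negbFE/z.
by apply: (iter_tensor_map_gt0 (j := j)) => //; rewrite lt_neqAle eq_sym xj x0.
Qed.

(** The orbit of a basis vector indexed in [J] stays supported on a single index of [J], so with
    [1 < n] each iterate has a zero coordinate. *)
Lemma trapped_support_not_primitive A (J : {set 'I_n}) :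
    (1 < m)%N -> (1 < n)%N -> J != set0 ->
    (forall j, j \in J -> exists2 s, s \in J &
       forall i, i != s -> majorization_matrix A i j = 0) ->
  ~ primitive_tensor A.
Proof.
move=> m1 n1 /set0Pn[j jJ] trapJ [_ [r [_ Ar]]].
pose x : 'cV[R]_n := delta_mx j 0.
have [s _ xs] : exists2 s, s \in J & supported_at s (iter r (tensor_map A) x).
  elim: (r) => [|q [s sJ xs]].
    by exists j => // k kj; rewrite mxE (negbTE kj).
  have [u uJ Mu] := trapJ s sJ; exists u => // k /Mu.
  exact: tensor_map_eq0.
have [k ks] : exists k, k != s.
  have [k ks|all_s] := pickP (fun k => k != s); first by exists k.
  suff: (#|'I_n| <= 1)%N by rewrite card_ord leqNgt n1.
  apply/fintype_le1P => u v.
  by rewrite (eqP (negbFE (all_s u))) (eqP (negbFE (all_s v))).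
suff: 0 < iter r (tensor_map A) x k 0 by rewrite xs // ltxx.
apply: Ar; first by move=> i; rewrite mxE ler0n.
by apply/eqP => /matrixP/(_ j 0)/eqP; rewrite !mxE !eqxx oner_eq0.
Qed.

End Supports.

Lemma ord2_neq (i j k : 'I_2) : i != j -> k != j -> k = i.
Proof.
by case: i j k => [[|[|?]] ?] [[|[|?]] ?] [[|[|?]] ?] //= _ _; apply: val_inj.
Qed.

(** Any [i] and [j] are joined in two steps through [d]: the term [M i d * M d j] of the square is
    positive, even when [i] or [j] equals [d]. *)
Lemma primitive_mx_offdiag (R : realType) (n : nat) (M : 'M[R]_n) :
    (forall i j, 0 <= M i j) ->
    (forall i j, i != j -> 0 < M i j) -> (exists d, 0 < M d d) ->
  primitive_matrix M.
Proof.
move=> M0 Moff [d Md]; split=> //; exists 2%N; split=> // i j.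
rewrite expr2 -mulmxE mxE (bigD1 d) //=; apply: ltr_pwDl.
  apply: mulr_gt0; first by have [->|/Moff] := eqVneq i d.
  by have [<-|/Moff] := eqVneq d j.
by apply: sumr_ge0 => l _; apply: mulr_ge0.
Qed.

Theorem theorem3p2 (R : realType) (m : nat) (hm : (2 <= m)%N)
    (A : tensor R m 2) (hA : nonneg_tensor A) :
  primitive_tensor A <-> primitive_matrix (majorization_matrix A).
Proof.
split; last exact: primitive_majorization_tensor (ltnW hm) hA.
set M := majorization_matrix A => primA.
have M0 i j : 0 <= M i j by rewrite mxE.
have Mgt0 i j : M i j != 0 -> 0 < M i j by rewrite lt_neqAle eq_sym M0 andbT.
apply: primitive_mx_offdiag => // [i j ij|].
  apply: Mgt0; apply/eqP => Mij0.
  (* As [i] is the only index besides [j], column [j] vanishes off the diagonal, so support at [j]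
     never leaves [j]. *)
  apply: (trapped_support_not_primitive (J := [set j])) primA => //.
    by apply/set0Pn; exists j; rewrite set11.
  move=> _ /set1P->; exists j; rewrite ?set11 // => k kj.
  by rewrite (ord2_neq ij kj).
have [d Md|diag0] := pickP (fun d => M d d != 0).
  by exists d; apply: Mgt0.
(* With a zero diagonal, support at one index moves to the other one, which is [rev_ord j]. *)
exfalso; apply: (trapped_support_not_primitive (J := setT)) primA => //.
  by apply/set0Pn; exists ord0.
move=> j _; exists (rev_ord j) => // i ij.
suff -> : i = j by exact/eqP/negbFE/diag0.
by apply: ord2_neq ij; case: j => [[|[|?]] ?].
Qed.
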